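(* Let $i\in\{1,\dots,k\}$, let $\delta_{\psi_i}(\underline U)=S_i\,\psi_i(\underline U)$ be a scale equivariant estimator of $\sigma_i$, where $\psi_i$ is a real-valued measurable function of $\underline U=(S_j/S_i)_{j\ne i}$, and let $\psi_{i0}$ be the truncation of $\psi_i$ defined in the context. If there exists some $\underline\sigma=(\sigma_1,\dots,\sigma_k)$ such that $P_{\underline\sigma}\big(\psi_{i0}(\underline U)\neq\psi_i(\underline U)\big)>0$, then, under the order restriction $\sigma_1\le\sigma_2\le\cdots\le\sigma_k$ and with respect to the linex loss $L(\sigma_i,\delta)=\exp\{p(\delta/\sigma_i-1)\}-p(\delta/\sigma_i-1)-1$, the estimator $\delta_{\psi_{i0}}=S_i\,\psi_{i0}(\underline U)$ improves upon $\delta_{\psi_i}=S_i\,\psi_i(\underline U)$.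
   Context: Let $k\ge2$ and let $n_1,\dots,n_k\ge1$ be integers, $n=\sum_{j=1}^k n_j$, and let $p\ne0$ be a fixed real number. For $i=1,\dots,k$, $(X_{i1},\dots,X_{in_i})$ is a random sample from the exponential distribution with known location $0$ and unknown scale $\sigma_i>0$ (density $\sigma_i^{-1}e^{-x/\sigma_i}$, $x>0$), and the $k$ samples are independent. Put $S_i=\sum_{j=1}^{n_i}X_{ij}$, so that $S_1,\dots,S_k$ are independent with $S_i\sim\mathrm{Gamma}(n_i,\sigma_i)$ (shape $n_i$, scale $\sigma_i$). The parameters satisfy $\sigma_1\le\sigma_2\le\cdots\le\sigma_k$. Scale equivariance is with respect to multiplying all observations in all samples by a common constant $a>0$. For fixed $i$, write $U_j=S_j/S_i$ for $j\ne i$ and $\underline U=(U_j)_{j\neq i}$, with values $\underline u=(u_j)_{j\ne i}$, $u_j>0$. Let $d=\frac1p\left(1-\exp\{-\frac{p}{n+1}\}\right)$ and define $\psi_{i*}(\underline u)=d$ if $i=1$ and $\psi_{i*}(\underline u)=d\,(1+\sum_{j=1}^{i-1}u_j)$ if $i=2,\dots,k$; $\psi_i^*(\underline u)=d\,(1+\sum_{j=2}^k u_j)$ if $i=1$ and $\psi_i^*(\underline u)=+\infty$ if $i=2,\dots,k$. (These are the infimum and supremum over $\sigma_1\le\cdots\le\sigma_k$ of $d\,(1+\sum_{j\ne i}u_j\sigma_i/\sigma_j)$.) For a given $\psi_i$, the truncation is $\psi_{i0}(\underline u)=\psi_{i*}(\underline u)$ if $\psi_i(\underline u)\le\psi_{i*}(\underline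 u)$; $\psi_{i0}(\underline u)=\psi_i(\underline u)$ if $\psi_{i*}(\underline u)<\psi_i(\underline u)<\psi_i^*(\underline u)$; $\psi_{i0}(\underline u)=\psi_i^*(\underline u)$ if $\psi_i(\underline u)\ge\psi_i^*(\underline u)$. The risk of an estimator $\delta$ is $E_{\underline\sigma}L(\sigma_i,\delta)$. An estimator $\delta'$ improves upon $\delta$ if its risk is at most that of $\delta$ for every $\underline\sigma$ with $\sigma_1\le\cdots\le\sigma_k$, with strict inequality for at least one such $\underline\sigma$.
   Formalization: For i ≥ 2 it is additionally assumed that the truncated estimator has finite risk at some ordered σ; without this both risks can be infinite at every σ (e.g. p > 0, ψ(u) = u_1² for large u_1 and 0 otherwise), so no strict improvement is possible. *)

(* Defs.v *)
From HB Require Import structures.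
From mathcomp Require Import all_boot all_order all_algebra.
From mathcomp Require Import all_classical all_reals all_analysis.

Set Implicit Arguments.
Unset Strict Implicit.
Unset Printing Implicit Defensive.

Import Order.TTheory GRing.Theory Num.Theory.
Import numFieldNormedType.Exports.

Local Open Scope classical_set_scope.
Local Open Scope ring_scope.

Section independence.
Context d (T : measurableType d) (R : realType).

Definition mutually_independent (P : probability T R) (I : finType)
    (X : I -> {mfun T >-> R}) : Prop :=
  forall (J : {set I}) (B : I -> set R),
    (forall a, measurable (B a)) ->
    P (\bigcap_(a in [set` J]) (X a @^-1` B a)) =
    (\prod_(a in J) P (X a @^-1` B a))%E.

End independence.

Section exponential_samples.
Context d (T : measurableType d) (R : realType).
Variables (k : nat) (n : 'I_k -> nat).

(* The parameter space: the scales are indexed from 0, so that sigma_1 of the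
   usual numbering is sigma at the least element of 'I_k. *)
Definition ordered_scales (sigma : 'I_k -> R) : Prop :=
  (forall j, 0 < sigma j) /\
  (forall j l : 'I_k, (j <= l)%N -> sigma j <= sigma l).

(* The k samples are independent and each consists of independent variables:
   all the X j l together form a mutually independent family. The library
   parametrizes exponential laws by the rate, the inverse of the scale. *)
Definition exponential_samples (X : forall j, 'I_(n j) -> {mfun T >-> R})
    (sigma : 'I_k -> R) (P : probability T R) : Prop :=
  mutually_independent P (fun a : {j : 'I_k & 'I_(n j)} => X (tag a) (tagged a))
  /\ forall j (l : 'I_(n j)) (B : set R), measurable B ->
       distribution P (X j l) B = exponential_prob (sigma j)^-1 B.

Definition sample_sum (X : forall j, 'I_(n j) -> {mfun T >-> R}) (j : 'I_k)
    (w : T) : R :=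
  \sum_(l < n j) X j l w.

(* A family (u_j)_{j != i} is a tuple of length k - 1 whose entry of rank j is
   u_(lift i j): lift i enumerates the indices other than i increasingly. *)
Definition ratios (S : 'I_k -> T -> R) (i : 'I_k) (w : T) : k.-1.-tuple R :=
  [tuple S (lift i j) w / S i w | j < k.-1].

Definition equivariant_estimator (S : 'I_k -> T -> R) (i : 'I_k)
    (psi : k.-1.-tuple R -> R) (w : T) : R :=
  S i w * psi (ratios S i w).

End exponential_samples.

Section truncation.
Context (R : realType).
Variables (k : nat) (p : R) (N : nat) (i : 'I_k).

Definition linex_const : R := p^-1 * (1 - expR (- (p / (N.+1)%:R))).

Definition psi_lower (u : k.-1.-tuple R) : R :=
  if i == 0%N :> nat then linex_const
  else linex_const * (1 + \sum_(j < k.-1 | (lift i j < i)%N) tnth u j).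

Definition psi_upper (u : k.-1.-tuple R) : \bar R :=
  if i == 0%N :> nat then (linex_const * (1 + \sum_(j < k.-1) tnth u j))%:E
  else +oo%E.

(* The last branch is reached only when psi_upper u is finite, so that fine
   loses nothing. *)
Definition truncation (psi : k.-1.-tuple R -> R) (u : k.-1.-tuple R) : R :=
  if psi u <= psi_lower u then psi_lower u
  else if ((psi u)%:E < psi_upper u)%E then psi u
  else fine (psi_upper u).

End truncation.

Section risk.
Context d (T : measurableType d) (R : realType).
Variables (k : nat) (p : R) (P : ('I_k -> R) -> probability T R) (i : 'I_k).

Definition linex (s delta : R) : R :=
  expR (p * (delta / s - 1)) - p * (delta / s - 1) - 1.

(* The linex loss is nonnegative: the risk is always defined, possibly +oo. *)
Definition risk (delta : T -> R) (sigma : 'I_k -> R) : \bar R :=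
  'E_(P sigma)[fun w => linex (sigma i) (delta w)]%E.

Definition improves_upon (delta' delta : T -> R) : Prop :=
  (forall sigma, ordered_scales sigma ->
     (risk delta' sigma <= risk delta sigma)%E) /\
  (exists sigma, ordered_scales sigma /\
     (risk delta' sigma < risk delta sigma)%E).

Definition finite_risk_somewhere (delta : T -> R) : Prop :=
  exists sigma, ordered_scales sigma /\ (risk delta sigma < +oo)%E.

End risk.

(* Main.v *)
Require Import Defs.
From HB Require Import structures.
From mathcomp Require Import all_boot all_order all_algebra.
From mathcomp Require Import all_classical all_reals all_analysis.
From mathcomp Require Import measurable_realfun ring lra.


(** The idea. Put N for the total sample size, d for the constant of the
    truncation, W = sum_j S_j / sigma_j, and write L for the loss as a function
    of the estimate of sigma_i. The estimate z = d * W * sigma_i is the best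
    multiple of W, and z = S_i * d * (1 + sum_{j != i} u_j sigma_i / sigma_j).
    Whatever the ordered scales are, the factor of S_i in it lies between the two
    truncation bounds, so the truncated estimate x0 always lies between the
    original estimate x and z ([truncation_between]).

    As L is convex, this gives pointwise
      L x - L x0 >= L' x0 * (x - x0) >= L' z * (x - x0)
                 = q * (exp (p * (d * W - 1)) - 1),  q = p (x - x0) / sigma_i,
    with a strict inequality where x0 <> x ([linex_gap], [linex_gap_lt]).
    It remains to see that the right-hand side has expectation 0. No
    conditional distribution is needed for this: q is homogeneous of degree 1 in
    the observations, and multiplying all observations by c > 0 has the same
    effect on their law as the density c^-N exp ((1 - 1/c) W)
    ([exponential_tilting]). Hence
      E (q exp ((1 - 1/c) W)) = c^(N+1) E q            ([homogeneous_tilting])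
    and c = exp (p / (N+1)), for which 1 - 1/c = p d and c^(N+1) = exp p, makes
    it E (q exp (p (d W - 1))) = E q ([weight_balance]): this is where the value
    of d comes from.

    Integrability comes for free when the risk of x is finite, the only case
    to treat: |x - x0| <= |x - z|, and L dominates the distance to sigma_i
    up to a constant ([linex_linear_growth]). Integrating gives the weak
    inequality at all ordered scales ([linex_risk_le]). It is strict at those
    where x0 has a finite risk and differs from x with positive probability
    ([linex_risk_lt]); the latter does not depend on the scales, since the
    laws of the sample under different scales have positive densities with
    respect to each other ([exponentials_absolutely_continuous]). For the
    smallest scale, x0 has a finite risk when all scales are equal, where it
    lies between 0 and z ([linex_risk_lty]). *)

Set Implicit Arguments.
Unset Strict Implicit.
Unset Printing Implicit Defensive.

Import Order.TTheory GRing.Theory Num.Theory.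
Import numFieldNormedType.Exports.

Local Open Scope classical_set_scope.
Local Open Scope ring_scope.

(** * Measures given by a density *)

Lemma measurable_neq_fun d (T : measurableType d) (R : realType) (f g : T -> R) :
  measurable_fun setT f -> measurable_fun setT g ->
  measurable [set t | f t <> g t].
Proof.
move=> mf mg; rewrite (_ : mkset _ = (fun t => f t - g t) @^-1` ~` [set 0]).
  rewrite -[_ @^-1` _]setTI; apply: measurable_funB => //; exact: measurableC.
apply/seteqP; split => t /= fg.
  by move=> /eqP; rewrite subr_eq0 => /eqP.
by move=> fg'; apply: fg; rewrite fg' subrr.
Qed.

Section density.
Context d d' (T : measurableType d) (U : measurableType d') (R : realType).
Variables (mu : {measure set T -> \bar R}) (phi : T -> R) (X : T -> U).
Hypotheses (mphi : measurable_fun setT phi) (phi0 : forall t, 0 <= phi t).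
Hypothesis mX : measurable_fun setT X.

Let mX1 (C : set U) : measurable C -> measurable (X @^-1` C).
Proof. by move=> mC; rewrite -[_ @^-1` _]setTI; exact: mX. Qed.

Lemma density_image_measure :
  exists m : {measure set U -> \bar R},
    forall C, m C = (\int[mu]_(t in X @^-1` C) (phi t)%:E)%E.
Proof.
pose m (C : set U) := (\int[mu]_(t in X @^-1` C) (phi t)%:E)%E.
have phi0' t : (0 <= (phi t)%:E)%E by rewrite lee_fin.
have m0 : m set0 = 0%E by rewrite /m preimage_set0 integral_set0.
have mge0 C : (0 <= m C)%E by apply: integral_ge0.
have madd : semi_sigma_additive m.
  move=> F mF tF mUF; rewrite /m; apply: cvg_toP.
    apply: ereal_nondecreasing_is_cvgn => a b ab.
    by apply: lee_sum_nneg_natr => // k _ _; exact: integral_ge0.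
  rewrite preimage_bigcup ge0_integral_bigcup//=.
  - by move=> k; exact: mX1.
  - by apply/measurable_EFinP; exact: measurable_funTS.
  - by move=> a b _ _ [t [ta tb]]; apply: tF => //; exists (X t).
pose mm := isMeasure.Build _ _ _ m m0 mge0 madd.
pose M : {measure set U -> \bar R} := HB.pack m mm.
by exists M.
Qed.

Import HBNNSimple.

(** Integrals against a law given by a density. Only the values of the two
    measures on sets are compared in the hypothesis, which is what uniqueness
    of measures provides; the passage to functions is by simple functions. *)
Lemma integral_density (nu : {measure set U -> \bar R}) (f : U -> \bar R) :
  (forall C, measurable C ->
     (\int[mu]_(t in X @^-1` C) (phi t)%:E)%E = nu C) ->
  measurable_fun setT f -> (forall u, (0 <= f u)%E) ->
  (\int[mu]_t (f (X t) * (phi t)%:E) = \int[nu]_u f u)%E.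
Proof.
move=> hnu mf f0.
pose h := nnsfun_approx measurableT mf.
have hcvg u : (h n u)%:E @[n --> \oo] --> f u by exact: cvg_nnsfun_approx.
have hnd u : {homo (fun n => h n u) : a b / (a <= b)%N >-> a <= b}.
  by move=> a b ab; exact/lefP/nd_nnsfun_approx.
have mhX (g : {nnsfun U >-> R}) : measurable_fun setT (fun t => (g (X t))%:E).
  by apply/measurable_EFinP; exact: measurableT_comp.
have mphiE : measurable_fun setT (fun t => (phi t)%:E) by exact/measurable_EFinP.
have -> : (\int[nu]_u f u = limn (fun n => \int[nu]_u (h n u)%:E))%E.
  transitivity (\int[nu]_u (limn (fun n => (h n u)%:E)))%E.
    by apply: eq_integral => u _; apply/esym/cvg_lim.
  apply: monotone_convergence => //.
  - by move=> n; exact/measurable_EFinP.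
  - by move=> n x _; rewrite lee_fin.
  - by move=> x _ a b ab; rewrite lee_fin hnd.
have -> : (\int[mu]_t (f (X t) * (phi t)%:E) =
           limn (fun n => \int[mu]_t ((h n (X t))%:E * (phi t)%:E)))%E.
  transitivity (\int[mu]_t (limn (fun n => (h n (X t))%:E * (phi t)%:E)))%E.
    by apply: eq_integral => t _; apply/esym/cvg_lim => //; exact: cvgeZr.
  apply: monotone_convergence => //.
  - by move=> n; exact: emeasurable_funM.
  - by move=> n x _; rewrite mule_ge0// lee_fin.
  - by move=> x _ a b ab; rewrite lee_wpmul2r// lee_fin// hnd.
congr (limn _); apply/funext => n; rewrite integralT_nnsfun sintegralE.
transitivity (\int[mu]_t (\sum_(y \in range (h n))
   (y * \1_(h n @^-1` [set y]) (X t))%:E * (phi t)%:E))%E.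
  apply: eq_integral => t _; rewrite fimfunE -fsumEFin//.
  by rewrite ge0_mule_fsuml// => y; exact: nnfun_muleindic_ge0.
rewrite ge0_integral_fsum//; last 2 first.
- move=> y; apply: emeasurable_funM => //; apply/measurable_EFinP.
  by apply: measurable_funM => //; exact: measurableT_comp.
- by move=> y t _; rewrite mule_ge0 ?nnfun_muleindic_ge0 ?lee_fin.
apply: eq_fsbigr => y /[!inE] -[u _ uy].
have y0 : 0 <= y by rewrite -uy.
under eq_integral => t _ do rewrite EFinM -muleA.
rewrite ge0_integralZl//=; last 2 first.
- apply: emeasurable_funM => //; apply/measurable_EFinP.
  by apply: measurableT_comp.
- by move=> t _; rewrite mule_ge0 ?lee_fin.
congr (_ * _)%E; rewrite -hnu// [RHS]integral_mkcond/=.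
apply: eq_integral => t _; rewrite patchE /indic.
rewrite (_ : (X t \in _) = (t \in X @^-1` (h n @^-1` [set y])))//.
by case: ifP; rewrite ?mul1e ?mul0e.
Qed.

End density.

(** * Joint laws of independent variables *)

Section function_space.
Context (R : realType) (I : finType).

(** The sigma-algebra on [I -> R] is generated by the rectangles themselves
    rather than by the coordinates, so that the rectangles are at hand as a
    pi-system when measures have to be identified. *)
Definition rectangles : set (set (I -> R)) :=
  [set A | exists2 B : I -> set R, (forall a, measurable (B a)) &
     A = [set x | forall a, B a (x a)]].

Definition fun_space := g_sigma_algebraType rectangles.

Lemma setI_closed_rectangles : setI_closed rectangles.
Proof.
move=> _ _ [B mB ->] [C mC ->]; exists (fun a => B a `&` C a).
  by move=> a; exact: measurableI.
apply/seteqP; split => [x [xB xC] a|x xBC]; first by split.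
by split => a; have [] := xBC a.
Qed.

Lemma measurable_coord (a : I) : measurable_fun setT (fun x : fun_space => x a).
Proof.
move=> _ B mB; rewrite setTI; apply: sub_sigma_algebra.
exists (fun b => if b == a then B else setT).
  by move=> b; case: ifP.
apply/seteqP; split => [x xB b|x /(_ a)]; last by rewrite eqxx.
by case: eqP => // ->.
Qed.

Lemma measurable_to_fun_space d (T : measurableType d) (X : I -> T -> R) :
  (forall a, measurable_fun setT (X a)) ->
  measurable_fun setT (fun t => (X ^~ t) : fun_space).
Proof.
move=> mX; apply: (@measurability _ _ _ fun_space _ _ rectangles) => // _ [_ [B mB ->] <-].
rewrite setTI (_ : _ @^-1` _ = \bigcap_(a in setT) (X a @^-1` B a)).
  apply: fin_bigcap_measurable => // a _.
  by rewrite -[_ @^-1` _]setTI; exact: mX.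
by apply/seteqP; split => [t tB a _|t tB a]; exact: tB.
Qed.

End function_space.

(** Stated for all the coordinates at once only: the rule for a subfamily is the
    case where the other [B a] are full. *)
Definition product_rule d (T : measurableType d) (R : realType) (I : finType)
    (P : probability T R) (X : I -> T -> R) : Prop :=
  forall B : I -> set R, (forall a, measurable (B a)) ->
    P [set t | forall a, B a (X a t)] = (\prod_a P (X a @^-1` B a))%E.

Section change_of_law.
Context d d' (T : measurableType d) (T' : measurableType d') (R : realType).
Context (I : finType).
Variables (P : probability T R) (P' : probability T' R).
Variables (X : I -> T -> R) (X' : I -> T' -> R) (r : I -> R -> R).
Hypotheses (mX : forall a, measurable_fun setT (X a))
           (mX' : forall a, measurable_fun setT (X' a)).

Hypotheses (indX : product_rule P X) (indX' : product_rule P' X').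
Hypotheses (mr : forall a, measurable_fun setT (r a))
           (r0 : forall a x, 0 <= r a x).
Hypothesis lawX' : forall a B, measurable B ->
  P' (X' a @^-1` B) = (\int[P]_(t in X a @^-1` B) (r a (X a t))%:E)%E.

Let mpreX a B : measurable B -> measurable (X a @^-1` B).
Proof. by move=> mB; rewrite -[_ @^-1` _]setTI; exact: mX. Qed.

Let mpreX' a B : measurable B -> measurable (X' a @^-1` B).
Proof. by move=> mB; rewrite -[_ @^-1` _]setTI; exact: mX'. Qed.

Let G (s : seq I) (B : I -> set R) a t : R :=
  (if a \in s then r a (X a t) else 1) * \1_(B a) (X a t).

Let mG s B a : measurable (B a) -> measurable_fun setT (G s B a).
Proof.
move=> mB; apply: measurable_funM.
  case: (a \in s); last exact: measurable_cst.
  exact: measurableT_comp.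
by apply: measurableT_comp => //; exact: measurable_indic.
Qed.

Let G0 s B a t : 0 <= G s B a t.
Proof. by rewrite mulr_ge0//; case: ifP. Qed.

Let p (s : seq I) (B : I -> set R) a : R :=
  fine (if a \in s then P' (X' a @^-1` B a) else P (X a @^-1` B a)).

(** The coordinates are reweighted one at a time: for the coordinate [b], the
    other factors form a density under which, by the previous stage, the law of
    [X b] is its old law up to a constant factor, so [integral_density] applies
    to it. *)
Let integral_partial_rectangle s B : uniq s -> (forall a, measurable (B a)) ->
  (\int[P]_t (\prod_a G s B a t)%:E = (\prod_a p s B a)%:E)%E.
Proof.
elim: s B => [B _ mB|b s IH B /= /andP[bs us] mB].
  rewrite -prodEFin.
  transitivity (P [set t | forall a, B a (X a t)]).
    rewrite -[X in P X]setIT -integral_indic//; last first.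
      rewrite (_ : mkset _ = \bigcap_(a in setT) (X a @^-1` B a)).
        by apply: fin_bigcap_measurable => // a _; exact: mpreX.
      by apply/seteqP; split => [t tB a _|t tB a]; exact: tB.
    apply: eq_integral => t _; congr _%:E; rewrite indicE.
    have [Bt|nBt] := pselect (forall a, B a (X a t)).
      rewrite mem_set// big1// => a _.
      by rewrite /G in_nil mul1r indicE mem_set.
    move/existsNP: (nBt) => [a nBa]; rewrite memNset//.
    by rewrite (bigD1 a)//= /G in_nil indicE memNset// mulr0 mul0r.
  rewrite indX//; apply: eq_bigr => a _; rewrite /p in_nil fineK//.
  by rewrite fin_num_measure//; exact: mpreX.
pose phi t := \prod_(a | a != b) G s B a t.
have mphi : measurable_fun setT phi.
  rewrite /phi; under eq_fun do rewrite -big_filter.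
  by apply: measurable_prod => a _; exact: mG.
have phi0 t : 0 <= phi t by apply: prodr_ge0.
have k0 : 0 <= \prod_(a | a != b) p s B a.
  by apply: prodr_ge0 => a _; apply: fine_ge0; case: ifP.
pose k : {nonneg R} := NngNum k0.
pose f x := (r b x * \1_(B b) x)%:E.
have mf : measurable_fun setT f.
  by apply/measurable_EFinP; apply: measurable_funM => //; exact: measurable_indic.
have f0 x : (0 <= f x)%E by rewrite lee_fin mulr_ge0.
pose Q : {measure set _ -> \bar R} := pushforward P (X b).
have hnu C : measurable C ->
    (\int[P]_(t in X b @^-1` C) (phi t)%:E)%E = mscale k (Q (mX b)) C.
  move=> mC; pose B' a := if a == b then C else B a.
  have mB' a : measurable (B' a) by rewrite /B'; case: ifP.
  have := IH B' us mB'.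
  have -> : \prod_a p s B' a = k%:num * fine (P (X b @^-1` C)).
    rewrite (bigD1 b)//= mulrC {2}/p /B' eqxx (negbTE bs); congr (_ * _).
    by apply: eq_bigr => a /negbTE ab; rewrite /p ab.
  rewrite EFinM fineK; last by rewrite fin_num_measure//; exact: mpreX.
  rewrite [in X in _ -> X]integral_mkcond /mscale/= /pushforward => <-.
  apply: eq_integral => t _; rewrite (bigD1 b)//= {1}/G.
  rewrite (negbTE bs) mul1r {1}/B' eqxx patchE indicE.
  rewrite (_ : (X b t \in C) = (t \in X b @^-1` C))//.
  case: ifP => _; last by rewrite mul0r.
  rewrite mul1r; congr _%:E; apply: eq_bigr => a /negbTE ab.
  by rewrite /G /B' ab.
transitivity (\int[P]_t (f (X b t) * (phi t)%:E))%E.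
  apply: eq_integral => t _; rewrite (bigD1 b)//= /G mem_head EFinM.
  congr (_ * _%:E)%E; apply: eq_bigr => a /negbTE ab.
  by rewrite inE ab.
rewrite (integral_density mphi phi0 (mX b) hnu mf f0).
rewrite ge0_integral_mscale//= ge0_integral_pushforward//.
rewrite [in RHS](bigD1 b)//= {2}/p mem_head EFinM fineK; last first.
  by rewrite fin_num_measure//; exact: mpreX'.
rewrite muleC lawX'//; congr (_ * _)%E.
  rewrite preimage_setT [RHS]integral_mkcond; apply: eq_integral => t _.
  rewrite /f/= patchE indicE (_ : (X b t \in B b) = (t \in X b @^-1` B b))//.
  by case: ifP => _; rewrite ?mulr1 ?mulr0.
congr _%:E; apply: eq_bigr => a /negbTE ab.
by rewrite /p inE ab.
Qed.

(** Densities of independent coordinates multiply: if the law of each [X' a] has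
    the density [r a] with respect to that of [X a], then the joint law of [X']
    has the product density. The two sides agree on rectangles by
    [integral_partial_rectangle], hence everywhere. *)
Lemma integral_change_of_law (F : fun_space R I -> \bar R) :
  measurable_fun setT F -> (forall x, (0 <= F x)%E) ->
  (\int[P]_t (F (X ^~ t) * (\prod_a r a (X a t))%:E) =
   \int[P']_t F (X' ^~ t))%E.
Proof.
move=> mF F0.
pose J t : fun_space R I := X ^~ t; pose J' t : fun_space R I := X' ^~ t.
have mJ : measurable_fun setT J by exact: measurable_to_fun_space.
have mJ' : measurable_fun setT J' by exact: measurable_to_fun_space.
pose phi t := \prod_a r a (X a t).
have mphi : measurable_fun setT phi.
  by apply: measurable_prod => a _; exact: measurableT_comp.
have phi0 t : 0 <= phi t by apply: prodr_ge0.
have [m mE] := density_image_measure P mphi phi0 mJ.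
pose Q : {measure set _ -> \bar R} := pushforward P' J'.
have hnu C : measurable C -> (\int[P]_(t in J @^-1` C) (phi t)%:E)%E = Q mJ' C.
  move=> mC; rewrite -mE.
  have m_rect A : rectangles A -> m A = Q mJ' A.
    move=> [B mB ->]; rewrite mE.
    transitivity (\int[P]_t (\prod_a G (index_enum I) B a t)%:E)%E.
      rewrite integral_mkcond; apply: eq_integral => t _; rewrite patchE.
      case: ifPn => [|/negP nBt].
        rewrite inE/= => Bt; congr _%:E; apply: eq_bigr => a _.
        by rewrite /G mem_index_enum indicE mem_set ?mulr1//; exact: Bt.
      have /existsNP[a nBa] : ~ forall a, B a (X a t).
        by move=> Bt; apply: nBt; rewrite inE.
      by rewrite (bigD1 a)//= /G indicE memNset// mulr0 mul0r.
    rewrite integral_partial_rectangle ?index_enum_uniq// -prodEFin.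
    rewrite /Q/= /pushforward [RHS](_ : _ = P' [set t | forall a, B a (X' a t)])//.
    rewrite indX'//; apply: eq_bigr => a _; rewrite /p mem_index_enum fineK//.
    by rewrite fin_num_measure//; exact: mpreX'.
  have rectT : rectangles (setT : set (I -> R)).
    by exists (fun=> setT) => //; apply/seteqP; split.
  apply: (@measure_unique _ R (fun_space R I) (@rectangles R I) (fun=> setT)
    _ _ _ _ m (Q mJ')) => //.
  - exact: setI_closed_rectangles.
  - by rewrite bigcup_const.
  - by move=> _; rewrite m_rect// /Q/= /pushforward preimage_setT probability_setT ltry.
rewrite (integral_density mphi phi0 mJ hnu mF F0).
by rewrite ge0_integral_pushforward.
Qed.

End change_of_law.

(** * Exponential laws *)

Section exponential_laws.
Context (R : realType).
Implicit Types a b c : R.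

Lemma exponential_pdf_val a x :
  exponential_pdf a x = if 0 <= x then a * expR (- a * x) else 0.
Proof.
case: ifPn => [x0|]; first by rewrite exponential_pdfE.
by rewrite -ltNge => x0; rewrite lt0_exponential_pdf.
Qed.

Lemma lebesgue_measure_scale c (C : set R) : 0 < c -> measurable C ->
  (\int[lebesgue_measure]_(x in ( *%R c) @^-1` C) c%:E)%E
    = lebesgue_measure C.
Proof.
move=> c0 mC.
have mc : measurable_fun setT ( *%R c : R -> R) by exact: mulrl_measurable.
have [m mE] := @density_image_measure _ _ (measurableTypeR R) (measurableTypeR R)
  R lebesgue_measure (cst c) ( *%R c) (measurable_cst c) (fun=> ltW c0) mc.
rewrite -mE; apply/esym.
apply: (@lebesgue_measure_unique R m) => // _ [[x y] _ <-].
rewrite mE (_ : _ @^-1` _ = `]x / c, y / c]%classic); last first.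
  apply/seteqP; split => z /=; rewrite !in_itv/= ler_pdivlMr// ltr_pdivrMr//.
    by rewrite !(mulrC z).
  by rewrite !(mulrC z).
transitivity (c%:E * @lebesgue_measure R [set` `]x / c, y / c]%R])%E; last first.
  exact/esym/(integral_cst lebesgue_measure (measurable_itv _) c%:E).
rewrite !lebesgue_measure_itv/= !lte_fin ltr_pM2r ?invr_gt0//.
case: ifP => _; last by rewrite mule0.
by rewrite -!EFinB -EFinM -mulrBl mulrCA divff ?mulr1// gt_eqF.
Qed.

Lemma exponential_prob_scale a c (B : set R) : 0 < a -> 0 < c -> measurable B ->
  exponential_prob a (( *%R c) @^-1` B) = exponential_prob (a / c) B.
Proof.
move=> a0 c0 mB.
pose f x := (exponential_pdf (a / c) x * \1_B x)%:E.
have ac0 : 0 <= a / c by rewrite divr_ge0// ltW.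
have mf : measurable_fun setT f.
  apply/measurable_EFinP; apply: measurable_funM.
    exact: measurable_exponential_pdf.
  exact: measurable_indic.
have f0 x : (0 <= f x)%E by rewrite lee_fin mulr_ge0// exponential_pdf_ge0.
have mc : measurable_fun setT ( *%R c : R -> R) by exact: mulrl_measurable.
have := @integral_density _ _ (measurableTypeR R) (measurableTypeR R) R
  lebesgue_measure (cst c) ( *%R c) (measurable_cst c) (fun=> ltW c0) mc
  lebesgue_measure f (fun C mC => lebesgue_measure_scale c0 mC) mf f0.
rewrite /exponential_prob => fE.
transitivity (\int[lebesgue_measure]_u f u)%E; last first.
  rewrite [RHS]integral_mkcond; apply: eq_integral => x _.
  by rewrite /f patchE indicE; case: ifP; rewrite ?mulr1 ?mulr0.
rewrite -fE [LHS]integral_mkcond; apply: eq_integral => x _.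
rewrite /f patchE indicE (_ : (x \in _) = (c * x \in B))//.
case: ifP => _; last by rewrite mulr0 mul0e.
rewrite mulr1 -EFinM !exponential_pdf_val pmulr_rge0//.
case: ifP => _; last by rewrite mul0r.
rewrite mulrAC divfK ?gt_eqF//; congr (_ * expR _)%:E.
by field; rewrite gt_eqF.
Qed.

Lemma exponential_prob_le0 a : exponential_prob a `]-oo, 0] = 0%E.
Proof.
rewrite /exponential_prob -integral_itv_bndo_bndc; last first.
  apply/measurable_EFinP; apply: measurable_funTS.
  exact: measurable_exponential_pdf.
apply: integral0_eq => x; rewrite /= in_itv/= => x0.
by rewrite lt0_exponential_pdf.
Qed.

Lemma exponential_change_of_rate d (T : measurableType d) (P : probability T R)
    (Y : T -> R) a b (B : set R) :
  measurable_fun setT Y -> 0 < a -> 0 < b -> measurable B ->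
  (forall C, measurable C -> P (Y @^-1` C) = exponential_prob a C) ->
  exponential_prob b B =
    (\int[P]_(t in Y @^-1` B) (b / a * expR ((a - b) * Y t))%:E)%E.
Proof.
move=> mY a0 b0 mB law.
pose r x := b / a * expR ((a - b) * x).
pose f x := (r x * \1_B x)%:E.
have r0 x : 0 <= r x by rewrite mulr_ge0 ?expR_ge0// divr_ge0// ltW.
have mf : measurable_fun setT f.
  apply/measurable_EFinP; apply: measurable_funM.
    rewrite /r; apply: measurable_funM => //; apply: measurableT_comp => //.
  exact: measurable_indic.
have f0 x : (0 <= f x)%E by rewrite lee_fin mulr_ge0.
pose Q : {measure set (measurableTypeR R) -> \bar R} :=
  pushforward P (Y : T -> measurableTypeR R).
have hnu C : measurable C ->
    (\int[lebesgue_measure]_(x in id @^-1` C) (exponential_pdf a x)%:E)%E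
      = Q mY C.
  by move=> mC; rewrite /Q/= /pushforward law.
have mpdf := @measurable_exponential_pdf R a.
have pdf0 := exponential_pdf_ge0 (ltW a0).
have /= := @integral_density _ _ (measurableTypeR R) (measurableTypeR R) R
  lebesgue_measure _ id mpdf pdf0 (@measurable_id _ _ setT) (Q mY) f hnu mf f0.
rewrite ge0_integral_pushforward//= preimage_setT => fE.
transitivity (\int[P]_t f (Y t))%E; last first.
  rewrite [RHS]integral_mkcond; apply: eq_integral => t _.
  rewrite /f patchE indicE (_ : (t \in _) = (Y t \in B))//.
  by case: ifP; rewrite ?mulr1 ?mulr0.
rewrite -fE /exponential_prob [LHS]integral_mkcond; apply: eq_integral => x _.
rewrite /f patchE indicE; case: ifP => _; last by rewrite mulr0 mul0e.
rewrite mulr1 -EFinM !exponential_pdf_val.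
case: ifP => _; last by rewrite mulr0.
rewrite /r mulrACA divfK ?gt_eqF// -expRD; congr (_ * expR _)%:E.
by ring.
Qed.

End exponential_laws.

(** * Scaling and exponential tilting of independent exponential variables *)

Definition independent_exponentials d (T : measurableType d) (R : realType)
    (I : finType) (P : probability T R) (X : I -> T -> R) (la : I -> R) : Prop :=
  [/\ forall a, measurable_fun setT (X a), product_rule P X &
      forall a C, measurable C -> P (X a @^-1` C) = exponential_prob (la a) C].

Section tilting.
Context d (T : measurableType d) (R : realType) (I : finType).
Variables (P : probability T R) (X : I -> T -> R) (la : I -> R).
Hypotheses (la_gt0 : forall a, 0 < la a) (expX : independent_exponentials P X la).

Lemma exponentials_change d' (T' : measurableType d') (P' : probability T' R)
    (X' : I -> T' -> R) (la' : I -> R) (F : fun_space R I -> \bar R) :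
  (forall a, 0 < la' a) -> independent_exponentials P' X' la' ->
  measurable_fun setT F -> (forall x, (0 <= F x)%E) ->
  (\int[P']_t F (X' ^~ t) = \int[P]_t (F (X ^~ t) *
     (\prod_a (la' a / la a * expR ((la a - la' a) * X a t)))%:E))%E.
Proof.
move=> la'_gt0 [mX' ruleX' lawX'] mF F0; have [mX ruleX lawX] := expX.
pose r a x := la' a / la a * expR ((la a - la' a) * x).
rewrite -(@integral_change_of_law _ _ T T' R I P P' X X' r)//.
- by move=> a; rewrite /r; apply: measurable_funM => //; exact: measurableT_comp.
- by move=> a x; rewrite mulr_ge0 ?expR_ge0// divr_ge0// ltW.
- move=> a B mB; rewrite lawX'//.
  by rewrite (exponential_change_of_rate (mX a) (la_gt0 a) (la'_gt0 a) mB (lawX a)).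
Qed.

Lemma independent_exponentials_scale (c : R) : 0 < c ->
  independent_exponentials P (fun a t => c * X a t) (fun a => la a / c).
Proof.
move=> c0; have [mX ruleX lawX] := expX; split.
- by move=> a; exact: measurable_funM.
- move=> B mB; rewrite (ruleX (fun a => ( *%R c) @^-1` B a))// => a.
  by rewrite -[_ @^-1` _]setTI; exact: mulrl_measurable.
- move=> a C mC; rewrite -exponential_prob_scale// -lawX//.
  by rewrite -[_ @^-1` _]setTI; exact: mulrl_measurable.
Qed.

Definition weighted_sum (x : fun_space R I) : R := \sum_a la a * x a.

Lemma measurable_weighted_sum : measurable_fun setT weighted_sum.
Proof.
apply: measurable_sum => a; apply: measurable_funM => //.
exact: measurable_coord.
Qed.

(** Multiplying the observations by [c] divides the rates by [c], and the
    corresponding density depends on the observations through the weighted sum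
    only: this is the sufficiency of that sum for a common scale. *)
Lemma exponential_tilting (c : R) (F : fun_space R I -> \bar R) : 0 < c ->
  measurable_fun setT F -> (forall x, (0 <= F x)%E) ->
  (\int[P]_t F (fun a => (c * X a t)%R) = \int[P]_t (F (X ^~ t) *
     (c ^- #|I| * expR ((1 - c^-1) * weighted_sum (X ^~ t)))%:E))%E.
Proof.
move=> c0 mF F0.
rewrite (exponentials_change _ (independent_exponentials_scale c0) mF F0); last first.
  by move=> a; rewrite divr_gt0.
apply: eq_integral => t _; congr (_ * _%:E)%E; rewrite big_split/=; congr (_ * _).
  rewrite -exprVn -prodr_const; apply: eq_bigr => a _.
  by rewrite mulrAC divff ?mul1r// gt_eqF.
rewrite -expR_sum mulr_sumr; congr expR; apply: eq_bigr => a _.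
by rewrite mulrA; congr (_ * _); rewrite mulrBl mul1r mulrC.
Qed.

(** The tilting identity replaces the conditional law of the weighted sum given
    the ratios: a factor homogeneous of degree 1 passes through it with no
    other change than the constant. *)
Lemma homogeneous_tilting (c : R) (F : fun_space R I -> R) : 0 < c ->
  measurable_fun setT F -> (forall x, 0 <= F x) ->
  (forall x, F (fun a => c * x a) = c * F x) ->
  (\int[P]_t (F (X ^~ t) * expR ((1 - c^-1) * weighted_sum (X ^~ t)))%:E =
   (c ^+ #|I|.+1)%:E * \int[P]_t (F (X ^~ t))%:E)%E.
Proof.
move=> c0 mF F0 FZ; have [mX _ _] := expX.
have mJ : measurable_fun setT (fun t => (X ^~ t) : fun_space R I).
  exact: measurable_to_fun_space.
have mFX : measurable_fun setT (fun t => F (X ^~ t)) by exact: measurableT_comp mJ.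
have mWX : measurable_fun setT (fun t => weighted_sum (X ^~ t)).
  exact: measurableT_comp measurable_weighted_sum mJ.
have mFE : measurable_fun setT (EFin \o F) by exact/measurable_EFinP.
have /= := exponential_tilting c0 mFE (fun x => F0 x).
under eq_integral do rewrite FZ EFinM.
rewrite ge0_integralZl//=; last 3 first.
- exact/measurable_EFinP.
- by move=> t _; rewrite lee_fin.
- by rewrite lee_fin ltW.
move=> H; rewrite exprS mulrC EFinM -muleA H -ge0_integralZl//=; last 3 first.
- apply: emeasurable_funM; apply/measurable_EFinP => //.
  apply: measurable_funM => //; apply: measurableT_comp => //.
  exact: measurable_funM.
- by move=> t _; rewrite mule_ge0 ?lee_fin ?mulr_ge0 ?expR_ge0// invr_ge0 exprn_ge0// ltW.
- by rewrite lee_fin exprn_ge0// ltW.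
apply: eq_integral => t _; rewrite -!EFinM; congr _%:E.
rewrite [RHS]mulrCA; congr (_ * _).
by rewrite mulrA divff ?mul1r// expf_neq0// gt_eqF.
Qed.

(** Tilting the constant 1 computes this moment: it is [c ^ #|I|]. *)
Lemma integrable_exp_weighted_sum (c : R) : 0 < c ->
  P.-integrable setT (fun t => (expR ((1 - c^-1) * weighted_sum (X ^~ t)))%:E).
Proof.
move=> c0; have [mX _ _] := expX.
have mJ : measurable_fun setT (fun t => (X ^~ t) : fun_space R I).
  exact: measurable_to_fun_space.
have mWX : measurable_fun setT (fun t => weighted_sum (X ^~ t)).
  exact: measurableT_comp measurable_weighted_sum mJ.
have mE : measurable_fun setT (fun t => expR ((1 - c^-1) * weighted_sum (X ^~ t))).
  by apply: measurableT_comp => //; exact: measurable_funM.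
apply/integrableP; split; first exact/measurable_EFinP.
under eq_integral do rewrite /= ger0_norm ?expR_ge0//.
have cN0 : 0 < c ^- #|I| by rewrite invr_gt0 exprn_gt0.
have /= := exponential_tilting c0 (measurable_cst 1%E) (fun=> lee01).
under [X in _ = X -> _]eq_integral do rewrite mul1e EFinM.
rewrite integral_cst//= mul1e [P _]probability_setT ge0_integralZl//=; last 2 first.
- exact/measurable_EFinP.
- by rewrite lee_fin ltW.
case: (\int[P]_t _)%E => [r|//|//]; first by rewrite ltry.
by rewrite gt0_muley ?lte_fin.
Qed.

(** Both exponential moments with exponents 1/2 and -1/2 are finite, and they
    dominate the absolute value. *)
Lemma integrable_weighted_sum : P.-integrable setT (fun t => (weighted_sum (X ^~ t))%:E).
Proof.
have [mX _ _] := expX.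
have mJ : measurable_fun setT (fun t => (X ^~ t) : fun_space R I).
  exact: measurable_to_fun_space.
have mWX : measurable_fun setT (fun t => weighted_sum (X ^~ t)).
  exact: measurableT_comp measurable_weighted_sum mJ.
(* The exponent 1 - 1/c is 1/2 for c = 2 and -1/2 for c = 2/3. *)
have i1 := integrable_exp_weighted_sum (ltr0n R 2 : 0 < 2).
have i2 : P.-integrable setT (fun t => (expR (- (2^-1) * weighted_sum (X ^~ t)))%:E).
  have -> : - (2^-1) = 1 - (2 / 3)^-1 :> R by field.
  by apply: integrable_exp_weighted_sum; rewrite divr_gt0.
apply: (le_integrable measurableT _ _ (integrableZl measurableT 2 (integrableD measurableT i1 i2))).
  exact/measurable_EFinP.
move=> t _; rewrite /= lee_fin; set w := weighted_sum _.
rewrite [leRHS]ger0_norm ?mulr_ge0 ?addr_ge0 ?expR_ge0//.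
have := expR_ge1Dx ((1 - 2^-1) * w); have := expR_ge1Dx (- (2^-1) * w).
have := expR_gt0 ((1 - 2^-1) * w); have := expR_gt0 (- (2^-1) * w).
by rewrite ler_norml; lra.
Qed.

Lemma exponentials_gt0 : {ae P, forall t, forall a, 0 < X a t}.
Proof.
have [mX _ lawX] := expX.
have H a : P.-negligible (X a @^-1` `]-oo, 0]).
  apply/negligibleP.
    by rewrite -[_ @^-1` _]setTI; exact: mX.
  by rewrite [LHS]lawX// exponential_prob_le0.
apply: filter_forall => a; apply: negligibleS (H a) => t /=.
by move/negP; rewrite -leNgt in_itv.
Qed.

End tilting.

(** * Convexity of the linex loss *)

Section linex_gap.
Context (R : realType).
Implicit Types u v w : R.

Lemma expR_tangent u v : (v - u) * expR u <= expR v - expR u.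
Proof.
have := expR_ge1Dx (v - u).
rewrite -(ler_pM2r (expR_gt0 u)) -expRD subrK; lra.
Qed.

Lemma expR_tangent_lt u v : u != v -> (v - u) * expR u < expR v - expR u.
Proof.
move=> uv; have vu : v - u != 0 by rewrite subr_eq0 eq_sym.
have := expR_gt1Dx vu.
rewrite -(ltr_pM2r (expR_gt0 u)) -expRD subrK; lra.
Qed.

(** Convexity: replacing the slope at [u] by the slope at a point on the other
    side of [u] than [v] decreases the increment in both directions. *)
Lemma expR_secant u v w : 0 <= (v - u) * (u - w) ->
  (v - u) * expR w <= (v - u) * expR u.
Proof.
have [uv|uv|->] := ltgtP u v; last by rewrite !subrr !mul0r.
- rewrite pmulr_rge0 ?subr_gt0// subr_ge0 => wu.
  by rewrite ler_pM2l ?subr_gt0// ler_expR.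
- rewrite nmulr_rge0 ?subr_lt0// subr_le0 => wu.
  by rewrite ler_nM2l ?subr_lt0// ler_expR.
Qed.

Variables (p s : R).
Hypotheses (p0 : p != 0) (s0 : 0 < s).

Let condition (x x0 z : R) : 0 <= (x - x0) * (x0 - z * s) ->
  0 <= (p * (x / s - 1) - p * (x0 / s - 1)) * (p * (x0 / s - 1) - p * (z - 1)).
Proof.
move=> h; rewrite (_ : _ * _ = (p / s) ^+ 2 * ((x - x0) * (x0 - z * s))).
  by rewrite mulr_ge0// sqr_ge0.
by field; rewrite gt_eqF.
Qed.

(** The loss is convex and [x0] lies between [x] and [z * s], so the derivative
    of the loss at [z * s] bounds its increment from [x0] to [x] from below. *)
Lemma linex_gap (x x0 z : R) : 0 <= (x - x0) * (x0 - z * s) ->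
  linex p s x0 + p * ((x - x0) / s) * (expR (p * (z - 1)) - 1) <= linex p s x.
Proof.
move=> /condition/expR_secant; rewrite /linex.
set u := p * (x0 / s - 1); set v := p * (x / s - 1) => h.
have -> : p * ((x - x0) / s) = v - u by rewrite /u /v; ring.
by have := expR_tangent u v; lra.
Qed.

Lemma linex_gap_lt (x x0 z : R) : 0 <= (x - x0) * (x0 - z * s) -> x0 != x ->
  linex p s x0 + p * ((x - x0) / s) * (expR (p * (z - 1)) - 1) < linex p s x.
Proof.
move=> /condition/expR_secant; rewrite /linex => h xx.
have : p * (x0 / s - 1) != p * (x / s - 1).
  apply: contra xx => /eqP /(mulfI p0) /addIr /(mulIf _) ->//.
  by rewrite invr_eq0 gt_eqF.
move: h; set u := p * (x0 / s - 1); set v := p * (x / s - 1) => h uv.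
have -> : p * ((x - x0) / s) = v - u by rewrite /u /v; ring.
by have := expR_tangent_lt uv; lra.
Qed.

Lemma linex_ge0 (x : R) : 0 <= linex p s x.
Proof. by rewrite /linex; have := expR_ge1Dx (p * (x / s - 1)); lra. Qed.

(** The loss controls the error, which makes the error integrable as soon as the
    risk is finite. *)
Lemma linex_linear_growth (x : R) : `|p * (x / s - 1)| <= linex p s x + 1.
Proof.
rewrite /linex; set y := p * _.
rewrite ler_norml; apply/andP; split; first by have := expR_gt0 y; lra.
have [y0|y0] := leP y 0; first by have := expR_gt0 y; lra.
(* The tangent at 0 is too weak for y > 0; its square at y / 2 is enough, as
   (1 + y / 2) ^ 2 - 2 y = (1 - y / 2) ^ 2. *)
have : (1 + y / 2) * (1 + y / 2) <= expR (y / 2) * expR (y / 2).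
  by apply: ler_pM => //; rewrite ?expR_ge1Dx//; lra.
rewrite -expRD -splitr; have := sqr_ge0 (1 - y / 2); rewrite expr2; lra.
Qed.

End linex_gap.

(** * Comparison of the risks of two homogeneous estimators *)

Section improvement.
Context d (T : measurableType d) (R : realType) (I : finType).
Variables (P : probability T R) (X : I -> T -> R) (la : I -> R).
Hypotheses (la_gt0 : forall a, 0 < la a) (expX : independent_exponentials P X la).
Variables (p s : R).
Hypotheses (p0 : p != 0) (s0 : 0 < s).

Let W t := weighted_sum la (X ^~ t).
Let D := linex_const p #|I|.

Definition homogeneous (g : fun_space R I -> R) : Prop :=
  forall c x, 0 < c -> g (fun a => c * x a) = c * g x.

Let mJ : measurable_fun setT (fun t => (X ^~ t) : fun_space R I).
Proof. by have [mX _ _] := expX; exact: measurable_to_fun_space. Qed.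

Let mW : measurable_fun setT W.
Proof. exact: measurableT_comp (measurable_weighted_sum la) mJ. Qed.

(** Up to a factor, [weight - 1] is the derivative of the loss at the best
    multiple of [W]. *)
Let weight t := expR (p * (D * W t - 1)).

Let mweight : measurable_fun setT weight.
Proof.
apply: measurableT_comp => //; apply: measurable_funM => //.
by apply: measurable_funB => //; exact: measurable_funM.
Qed.

(** The constant [D] is the one for which the weight leaves the expectation of
    functions homogeneous of degree 1 unchanged: [p * D = 1 - 1 / c] and
    [c ^ #|I|.+1 = expR p] for [c = expR (p / #|I|.+1)]. *)
Lemma weight_balance (g : fun_space R I -> R) :
  measurable_fun setT g -> (forall x, 0 <= g x) -> homogeneous g ->
  (\int[P]_t (g (X ^~ t) * weight t)%:E = \int[P]_t (g (X ^~ t))%:E)%E.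
Proof.
move=> mg g0 gZ; pose c := expR (p / #|I|.+1%:R).
have c0 : 0 < c by exact: expR_gt0.
have cN : c ^+ #|I|.+1 = expR p.
  by rewrite -expRM_natl mulrC divfK// pnatr_eq0.
have := homogeneous_tilting la_gt0 expX c0 mg g0 (fun x => gZ c x c0).
rewrite cN => H.
have mgX : measurable_fun setT (fun t => g (X ^~ t)) by exact: measurableT_comp mJ.
transitivity (\int[P]_t ((expR (- p))%:E *
    (g (X ^~ t) * expR ((1 - c^-1) * W t))%:E))%E.
  apply: eq_integral => t _; rewrite -EFinM mulrCA; congr (_ * _)%:E.
  rewrite -expRD; congr expR; rewrite mulrBr mulr1 addrC mulrA; congr (_ + _ * _).
  by rewrite /D /linex_const mulrA divff// mul1r expRN.
rewrite ge0_integralZl//=; last 2 first.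
- apply/measurable_EFinP; apply: measurable_funM => //.
  by apply: measurableT_comp => //; exact: measurable_funM.
- by move=> t _; rewrite lee_fin mulr_ge0// expR_ge0.
by rewrite H muleA -EFinM -expRD addNr expR0 mul1e.
Qed.

Let mX_of (g : fun_space R I -> R) :
  measurable_fun setT g -> measurable_fun setT (fun t => g (X ^~ t)).
Proof. by move=> mg; exact: measurableT_comp mJ. Qed.

Let L (g : fun_space R I -> R) t := linex p s (g (X ^~ t)).

Let mL g : measurable_fun setT g -> measurable_fun setT (L g).
Proof.
move=> /mX_of mg; rewrite /L /linex.
have m1 : measurable_fun setT (fun t => p * (g (X ^~ t) / s - 1)).
  apply: measurable_funM => //; apply: measurable_funB => //.
  exact: measurable_funM.
apply: measurable_funB => //; apply: measurable_funB => //.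
exact: measurableT_comp.
Qed.

Let pD : p * D = 1 - (expR (p / #|I|.+1%:R))^-1.
Proof. by rewrite /D /linex_const mulrA divff// mul1r expRN. Qed.

(** The moment [expR (p * D * W)] is finite, being one of those computed by
    tilting; together with the mean of [W] it dominates the loss of any
    estimator between 0 and [D * W * s]. *)
Lemma linex_risk_lty (g : fun_space R I -> R) : measurable_fun setT g ->
  {ae P, forall t, 0 <= g (X ^~ t) <= D * W t * s} ->
  (\int[P]_t (linex p s (g (X ^~ t)))%:E < +oo)%E.
Proof.
move=> mg gae.
have iE := integrable_exp_weighted_sum la_gt0 expX (expR_gt0 (p / #|I|.+1%:R)).
have iW := integrable_weighted_sum la_gt0 expX.
pose K t := expR (- p) * (1 + expR (p * D * W t)) + (`|p| + `|p * D| * `|W t|).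
have iK : P.-integrable setT (EFin \o K).
  have i1 r := @finite_measure_integrable_cst _ T R P setT r measurableT.
  rewrite -pD in iE.
  have i2 := integrableZl measurableT (expR (- p)) (integrableD measurableT (i1 1) iE).
  have i3 := integrableZl measurableT `|p * D| (integrable_abse iW).
  exact: (integrableD measurableT i2 (integrableD measurableT (i1 `|p|) i3)).
apply: le_lt_trans (integrable_lty measurableT iK).
apply: ae_ge0_le_integral => //.
- by move=> t _; rewrite lee_fin linex_ge0.
- by apply/measurable_EFinP; exact: mL.
- move=> t _; rewrite lee_fin addr_ge0 ?mulr_ge0 ?addr_ge0 ?mulr_ge0 ?expR_ge0//.
- exact: measurable_int iK.
move: gae; apply: filterS => t /andP[g0 gW] _; rewrite lee_fin /K /linex.
set y := g _ / s.
have y0 : 0 <= y by rewrite divr_ge0// ltW.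
have yW : y <= D * W t by rewrite ler_pdivrMr.
have -> : expR (p * (y - 1)) = expR (- p) * expR (p * y).
  by rewrite -expRD; congr expR; ring.
have le1 : expR (p * y) <= 1 + expR (p * D * W t).
  have [pp|pp] := leP 0 p.
    by apply: ler_wpDl => //; rewrite ler_expR -mulrA; exact: ler_wpM2l.
  apply: ler_wpDr; first exact: expR_ge0.
  by rewrite -expR0 ler_expR nmulr_rle0.
have le2 := ler_wpM2l (expR_ge0 (- p)) le1.
have : - (p * y) <= `|p * D| * `|W t|.
  rewrite (le_trans (ler_norm _))// normrN -normrM -mulrA !(normrM p).
  by apply: ler_wpM2l => //; rewrite !ger0_norm// (le_trans y0).
have := ler_norm p; lra.
Qed.

Variables (f f0 : fun_space R I -> R).
Hypotheses (mf : measurable_fun setT f) (mf0 : measurable_fun setT f0).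
Hypotheses (fZ : homogeneous f) (f0Z : homogeneous f0).
Hypothesis between : {ae P, forall t,
  0 <= (f (X ^~ t) - f0 (X ^~ t)) * (f0 (X ^~ t) - D * W t * s)}.

(* The increment of the linex exponent. Its positive and negative parts are
   separated so that the balance identity, stated for nonnegative functions,
   applies to each. *)
Let q x := p * ((f x - f0 x) / s).
Let qp x := Num.max (q x) 0.
Let qn x := Num.max (- q x) 0.

Let mq : measurable_fun setT q.
Proof.
by apply: measurable_funM => //; apply: measurable_funM => //; exact: measurable_funB.
Qed.

Let mqp : measurable_fun setT qp.
Proof. exact: measurable_maxr. Qed.

Let mqn : measurable_fun setT qn.
Proof. by apply: measurable_maxr => //; exact: measurableT_comp. Qed.

Let qp0 x : 0 <= qp x. Proof. by rewrite le_max lexx orbT. Qed.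
Let qn0 x : 0 <= qn x. Proof. by rewrite le_max lexx orbT. Qed.

Let qZ : homogeneous q.
Proof. by move=> c x c0; rewrite /q fZ// f0Z//; ring. Qed.

Let qpZ : homogeneous qp.
Proof. by move=> c x c0; rewrite /qp qZ// maxr_pMr ?ltW// mulr0. Qed.

Let qnZ : homogeneous qn.
Proof. by move=> c x c0; rewrite /qn qZ// maxr_pMr ?ltW// mulr0 mulrN. Qed.

Let q_pn x : q x = qp x - qn x.
Proof.
rewrite /qp /qn; have /orP[q0|q0] := le_total 0 (q x).
  by rewrite max_l// max_r ?oppr_le0// subr0.
by rewrite max_r// max_l ?oppr_ge0// sub0r opprK.
Qed.

Let q_norm x : `|q x| = qp x + qn x.
Proof.
rewrite /qp /qn; have /orP[q0|q0] := le_total 0 (q x).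
  by rewrite ger0_norm// max_l// max_r ?oppr_le0// addr0.
by rewrite ler0_norm// max_r// max_l ?oppr_ge0// add0r.
Qed.

Let weight_balance2 (g h : fun_space R I -> R) :
  measurable_fun setT g -> measurable_fun setT h ->
  (forall x, 0 <= g x) -> (forall x, 0 <= h x) -> homogeneous g ->
  (\int[P]_t (g (X ^~ t) * weight t + h (X ^~ t))%:E =
   \int[P]_t (g (X ^~ t) + h (X ^~ t))%:E)%E.
Proof.
move=> mg mh g0 h0 gZ.
have mgX := mX_of mg; have mhX := mX_of mh.
under eq_integral do rewrite EFinD.
under [RHS]eq_integral do rewrite EFinD.
rewrite !ge0_integralD ?weight_balance//=.
all: try by move=> t _; rewrite lee_fin ?mulr_ge0// expR_ge0.
all: apply/measurable_EFinP => //; exact: measurable_funM.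
Qed.

Let a t := qp (X ^~ t) * weight t + qn (X ^~ t).
Let b t := qn (X ^~ t) * weight t + qp (X ^~ t).

Let a0 t : 0 <= a t.
Proof. by rewrite addr_ge0// mulr_ge0// expR_ge0. Qed.

Let b0 t : 0 <= b t.
Proof. by rewrite addr_ge0// mulr_ge0// expR_ge0. Qed.

Let ma : measurable_fun setT a.
Proof.
exact: measurable_funD (measurable_funM (mX_of mqp) mweight) (mX_of mqn).
Qed.

Let mb : measurable_fun setT b.
Proof.
exact: measurable_funD (measurable_funM (mX_of mqn) mweight) (mX_of mqp).
Qed.

Let integral_a : (\int[P]_t (a t)%:E = \int[P]_t `|q (X ^~ t)|%:E)%E.
Proof.
by rewrite weight_balance2//; apply: eq_integral => t _; rewrite q_norm.
Qed.

Let integral_b : (\int[P]_t (b t)%:E = \int[P]_t `|q (X ^~ t)|%:E)%E.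
Proof.
by rewrite weight_balance2//; apply: eq_integral => t _; rewrite q_norm addrC.
Qed.

(** The inequality of [linex_gap] with its negative terms moved to the other
    side, so that all integrals are of nonnegative functions. *)
Let gap : {ae P, forall t, L f0 t + a t <= L f t + b t}.
Proof.
move: between; apply: filterS => t /(linex_gap p s0).
by rewrite -[p * _]/(q (X ^~ t)) q_pn /L /a /b /weight; lra.
Qed.

(** As [f0] lies between [f] and [D * W * s], the difference [f - f0] is at most
    the distance from [f] to [D * W * s]. *)
Let integrable_q : (\int[P]_t (L f t)%:E < +oo)%E ->
  (\int[P]_t `|q (X ^~ t)|%:E < +oo)%E.
Proof.
move=> fin.
have iW := integrable_weighted_sum la_gt0 expX.
pose K t := L f t + (1 + `|p|) + `|p * D| * `|W t|.
have iK : P.-integrable setT (EFin \o K).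
  have iL : P.-integrable setT (EFin \o L f).
    apply/integrableP; split; first exact/measurable_EFinP/mL.
    by under eq_integral do rewrite /= ger0_norm ?linex_ge0//.
  have i1 := @finite_measure_integrable_cst _ T R P setT (1 + `|p|) measurableT.
  have i2 := integrableZl measurableT `|p * D| (integrable_abse iW).
  exact: (integrableD measurableT (integrableD measurableT iL i1) i2).
apply: le_lt_trans (integrable_lty measurableT iK).
apply: ae_ge0_le_integral => //.
- by apply/measurable_EFinP; apply: measurableT_comp => //; exact: mX_of.
- by move=> t _; rewrite lee_fin addr_ge0 ?mulr_ge0// addr_ge0 ?linex_ge0// addr_ge0.
- exact: measurable_int iK.
move: between; apply: filterS => t bt _; rewrite lee_fin /K.
have := linex_linear_growth p s (f (X ^~ t)).
rewrite -/(L f t) /q; set x := f _ in bt *; set x0 := f0 _ in bt *.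
move=> growth.
have xx0 : `|x - x0| <= `|x - D * W t * s|.
  rewrite ler_norml; have := ler_norm (x - D * W t * s).
  have := ler_norm (- (x - D * W t * s)); rewrite normrN.
  move: bt; set z := D * W t * s => bt; nra.
have : `|p * ((x - x0) / s)| <= `|p * ((x - D * W t * s) / s)|.
  by rewrite !normrM ler_wpM2l// ler_wpM2r.
move=> /le_trans; apply.
rewrite (_ : p * _ = p * (x / s - 1) + p + - (p * D * W t)); last first.
  by field; rewrite gt_eqF.
apply: (le_trans (ler_normD _ _)); rewrite normrN normrM.
rewrite lerD2r; apply: (le_trans (ler_normD _ _)); lra.
Qed.

Lemma linex_risk_le :
  (\int[P]_t (linex p s (f0 (X ^~ t)))%:E <= \int[P]_t (linex p s (f (X ^~ t)))%:E)%E.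
Proof.
have [fin|] := ltP (\int[P]_t (L f t)%:E)%E +oo%E; last first.
  by rewrite leye_eq => /eqP; rewrite /L => ->; rewrite leey.
have Afin := integrable_q fin.
have A0 : (0 <= \int[P]_t `|q (X ^~ t)|%:E)%E by exact: integral_ge0.
rewrite -(@leeD2rE _ (\int[P]_t `|q (X ^~ t)|%:E)%E); last first.
  by rewrite ge0_fin_numE.
rewrite -{1}integral_a -integral_b -!ge0_integralD//=.
all: try by move=> t _; rewrite lee_fin ?linex_ge0 ?a0 ?b0.
all: try exact/measurable_EFinP/mL.
all: try exact/measurable_EFinP.
apply: ae_ge0_le_integral => //=.
- by move=> t _; rewrite -EFinD lee_fin addr_ge0 ?linex_ge0 ?a0.
- by apply: emeasurable_funD; apply/measurable_EFinP => //; exact: mL.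
- by move=> t _; rewrite -EFinD lee_fin addr_ge0 ?linex_ge0 ?b0.
- by apply: emeasurable_funD; apply/measurable_EFinP => //; exact: mL.
by move: gap; apply: filterS => t Lt _; rewrite -!EFinD lee_fin.
Qed.

(** If the risks were equal, the nonnegative difference of the two sides of
    [gap] would have integral 0, hence vanish almost everywhere, although it is
    positive where [f0] and [f] differ. *)
Lemma linex_risk_lt :
  (\int[P]_t (linex p s (f (X ^~ t)))%:E < +oo)%E ->
  (0 < P [set t | f0 (X ^~ t) <> f (X ^~ t)])%E ->
  (\int[P]_t (linex p s (f0 (X ^~ t)))%:E < \int[P]_t (linex p s (f (X ^~ t)))%:E)%E.
Proof.
move=> fin pos; rewrite lt_neqAle linex_risk_le andbT; apply/eqP => eqL.
have Afin := integrable_q fin.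
have int_ge0 (g : T -> R) : measurable_fun setT g -> (forall t, 0 <= g t) ->
    (\int[P]_t (g t)%:E < +oo)%E -> P.-integrable setT (EFin \o g).
  move=> mg g0 gfin; apply/integrableP; split; first exact/measurable_EFinP.
  by under eq_integral do rewrite /= ger0_norm//.
have iL : P.-integrable setT (EFin \o L f).
  by apply: int_ge0 => //; [exact: mL|move=> t; exact: linex_ge0].
have iL0 : P.-integrable setT (EFin \o L f0).
  apply: int_ge0 => //; [exact: mL|by move=> t; exact: linex_ge0|].
  by rewrite [ltLHS]eqL.
have ia : P.-integrable setT (EFin \o a) by apply: int_ge0; rewrite ?integral_a.
have ib : P.-integrable setT (EFin \o b) by apply: int_ge0; rewrite ?integral_b.
pose h t := (L f t + b t) - (L f0 t + a t).
have ih : P.-integrable setT (EFin \o h).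
  exact: (integrableB measurableT (integrableD measurableT iL ib)
    (integrableD measurableT iL0 ia)).
have h0 : (\int[P]_t (h t)%:E = 0)%E.
  under eq_integral do rewrite EFinB.
  rewrite (integralB_EFin measurableT (integrableD measurableT iL ib)
    (integrableD measurableT iL0 ia))/=.
  rewrite (integralD_EFin measurableT iL ib) (integralD_EFin measurableT iL0 ia)/=.
  rewrite integral_a integral_b [(\int[P]_t (L f0 t)%:E)%E]eqL.
  rewrite subee// fin_numD; apply/andP; split.
    by have /integrable_fin_num := iL; apply.
  by rewrite ge0_fin_numE// integral_ge0.
have : (\int[P]_t `|(h t)%:E| = 0)%E.
  rewrite -h0; apply: ae_eq_integral => //.
  - by apply: measurableT_comp => //; exact: measurable_int ih.
  - exact: measurable_int ih.
  move: gap; apply: filterS => t Lt _; rewrite gee0_abs// lee_fin /h subr_ge0//.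
move/(ae_eq_integral_abs P measurableT (measurable_int _ ih)) => hae.
move: pos; rewrite (_ : P _ = 0%E) ?ltxx//.
apply: measure_negligible.
  by apply: measurable_neq_fun; exact: mX_of.
suff : {ae P, forall t, f0 (X ^~ t) = f (X ^~ t)} by [].
move: hae between; apply: filterS2 => t ht0 bt.
have /eqP := ht0 Logic.I; rewrite eqe => /eqP ht.
apply: contrapT => /eqP /(linex_gap_lt p0 s0 bt).
rewrite -[p * _]/(q (X ^~ t)) q_pn => Lt.
by move: ht Lt; rewrite /h /L /a /b /weight; lra.
Qed.

End improvement.

(** * Absolute continuity between different scales, and the truncated estimator *)

Section absolute_continuity.
Context d d' (T : measurableType d) (T' : measurableType d') (R : realType).
Context (I : finType) (P : probability T R) (P' : probability T' R).
Variables (X : I -> T -> R) (X' : I -> T' -> R) (la la' : I -> R).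

(** Whether an event has positive probability does not depend on the rates,
    because the change of rates has a density. *)
Lemma exponentials_absolutely_continuous (A : set (fun_space R I)) :
  (forall a, 0 < la a) -> (forall a, 0 < la' a) ->
  independent_exponentials P X la -> independent_exponentials P' X' la' ->
  measurable A ->
  (0 < P' [set t | A (X' ^~ t)])%E -> (0 < P [set t | A (X ^~ t)])%E.
Proof.
move=> la0 la'0 expX expX' mA; rewrite !lt0e !measure_ge0 !andbT.
apply: contra => /eqP PA0; apply/eqP.
have mS d1 (T1 : measurableType d1) (Q : probability T1 R) (Y : I -> T1 -> R) mu :
    independent_exponentials Q Y mu -> measurable [set t | A (Y ^~ t)].
  case=> mY _ _; rewrite -[mkset _]setTI.
  by have := measurable_to_fun_space mY; apply.
pose F (x : fun_space R I) : \bar R := (\1_A x)%:E.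
have mF : measurable_fun setT F.
  by apply/measurable_EFinP; exact: (@measurable_indic _ (fun_space R I)).
have F0 x : (0 <= F x)%E by rewrite lee_fin.
have := exponentials_change la0 expX la'0 expX' mF F0.
have [mX _ _] := expX.
have FE : (\int[P']_t F (X' ^~ t) = P' [set t | A (X' ^~ t)])%E.
  rewrite -[RHS](_ : (\int[P']_t (\1_[set t | A (X' ^~ t)] t)%:E)%E = _).
    apply: eq_integral => t _; rewrite /F !indicE.
    by rewrite (_ : (X' ^~ t \in A) = (t \in [set t | A (X' ^~ t)])).
  by rewrite integral_indic ?setIT//; exact: mS expX'.
rewrite FE => ->.
rewrite (ae_eq_integral (cst 0%E))//; first by rewrite integral0.
  apply: emeasurable_funM.
    exact: measurableT_comp (measurable_to_fun_space mX).
  apply/measurable_EFinP; apply: measurable_prod => a _.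
  apply: measurable_funM => //; apply: measurableT_comp => //.
  exact: measurable_funM.
have : P.-negligible [set t | A (X ^~ t)].
  by apply/negligibleP => //; exact: mS expX.
apply: negligibleS => t /= /not_implyP[_]; apply: contra_notP => nA.
by rewrite /F indicE memNset// mul0e.
Qed.

End absolute_continuity.

Section estimators.
Context (R : realType).

Lemma measurable_invr : measurable_fun setT (GRing.inv : R -> R).
Proof.
(* A globally valid formula for the inverse, with 0^-1 = 0. *)
rewrite (_ : GRing.inv = fun x : R => x * (x * x) `^ (-1)).
  apply: measurable_funM => //; apply: (measurableT_comp (measurable_powR _)).
  exact: measurable_funM.
apply/funext => x; have [->|x0] := eqVneq x 0; first by rewrite mul0r invr0.
by rewrite powR_inv1 -?expr2 ?sqr_ge0// expr2 invfM mulrA divff// mul1r.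
Qed.

Section measurability.
Context d (T : measurableType d) (k : nat) (S : 'I_k -> T -> R) (i : 'I_k).
Hypothesis mS : forall j, measurable_fun setT (S j).

Lemma measurable_ratios : measurable_fun setT (ratios S i).
Proof.
apply/measurable_fun_tnthP => j.
rewrite (_ : _ \o _ = fun w => S (lift i j) w / S i w); last first.
  by apply/funext => w; rewrite /= tnth_mktuple.
apply: measurable_funM => //; exact: measurableT_comp measurable_invr _.
Qed.

Lemma measurable_equivariant_estimator (psi : k.-1.-tuple R -> R) :
  measurable_fun setT psi ->
  measurable_fun setT (equivariant_estimator S i psi).
Proof.
move=> mpsi; apply: measurable_funM => //.
exact: measurableT_comp mpsi measurable_ratios.
Qed.

Lemma measurable_truncation (p : R) (N : nat) (psi : k.-1.-tuple R -> R) :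
  measurable_fun setT psi -> measurable_fun setT (truncation p N i psi).
Proof.
move=> mpsi.
have ml : measurable_fun setT (psi_lower p N i).
  rewrite /psi_lower; case: (nat_of_ord i == 0%N); first exact: measurable_cst.
  apply: measurable_funM => //; apply: measurable_funD => //.
  under eq_fun do rewrite -big_filter.
  by apply: measurable_sum => j; exact: measurable_tnth.
have mu : measurable_fun setT (psi_upper p N i).
  rewrite /psi_upper; case: (nat_of_ord i == 0%N); last exact: measurable_cst.
  apply/measurable_EFinP; apply: measurable_funM => //.
  apply: measurable_funD => //.
  by apply: measurable_sum => j; exact: measurable_tnth.
apply: measurable_fun_ifT => //; first exact: measurable_fun_ler.
apply: measurable_fun_ifT => //; last exact: measurableT_comp.
by apply: measurable_fun_lte => //; exact/measurable_EFinP.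
Qed.

End measurability.

Section truncation_between.
Context d (T : measurableType d) (k : nat) (S : 'I_k -> T -> R) (i : 'I_k).
Variables (p : R) (N : nat) (sigma : 'I_k -> R) (w : T).
Hypotheses (p0 : p != 0) (sigma_ord : ordered_scales sigma).
Hypothesis S0 : forall j, 0 < S j w.

Let sigma0 j : 0 < sigma j. Proof. by case: sigma_ord => + _; apply. Qed.

Lemma linex_const_gt0 : 0 < linex_const p N.
Proof.
rewrite /linex_const; case: (ltgtP p 0) p0 => // pp _.
  rewrite nmulr_rgt0 ?invr_lt0// subr_lt0 expR_gt1 oppr_gt0.
  by rewrite pmulr_llt0 ?invr_gt0 ?ltr0n.
rewrite pmulr_rgt0 ?invr_gt0// subr_gt0 -expR0 ltr_expR oppr_lt0.
by rewrite divr_gt0 ?ltr0n.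
Qed.

Let u := ratios S i w.
(** The ratio of the weighted sum, brought to the scale of [S i], to [S i]: the
    bounds of the truncation are, up to the constant, the infimum and the
    supremum of this quantity over the ordered scales. *)
Let A : R := 1 + \sum_(j < k.-1) tnth u j * (sigma i / sigma (lift i j)).

Let u0 j : 0 <= tnth u j.
Proof. by rewrite tnth_mktuple divr_ge0 ?ltW. Qed.

Let weighted_sumE : (\sum_j S j w / sigma j) * sigma i = S i w * A.
Proof.
rewrite (bigD1_ord i)//= /A mulrDl divfK ?gt_eqF// mulrDr mulr1; congr (_ + _).
rewrite mulr_suml mulr_sumr; apply: eq_bigr => j _.
rewrite tnth_mktuple; field.
by rewrite !gt_eqF ?S0 ?sigma0.
Qed.

(* Ratios of scales are at least 1 below the index i and nonnegative above. *)
Let lower_le : psi_lower p N i u <= linex_const p N * A.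
Proof.
rewrite (_ : psi_lower _ _ _ _ =
    linex_const p N * (1 + \sum_(j < k.-1 | (lift i j < i)%N) tnth u j)).
  rewrite ler_pM2l ?linex_const_gt0// lerD2l big_mkcond/=; apply: ler_sum => j _.
  case: ifPn => [ji|_]; last by rewrite mulr_ge0 ?u0// divr_ge0 ?ltW.
  rewrite ler_peMr// ler_pdivlMr// mul1r.
  by case: sigma_ord => _; apply; exact: ltnW.
rewrite /psi_lower; case: ifP => // /eqP i0.
by rewrite big_pred0 ?addr0 ?mulr1// => j; rewrite i0.
Qed.

(* For the least index, all the ratios of scales are at most 1. *)
Let upper_ge : ((linex_const p N * A)%:E <= psi_upper p N i u)%E.
Proof.
rewrite /psi_upper; case: ifP => [/eqP i0|_]; last by rewrite leey.
rewrite lee_fin ler_pM2l ?linex_const_gt0// lerD2l; apply: ler_sum => j _.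
rewrite ler_piMr// ler_pdivrMr// mul1r.
by case: sigma_ord => _; apply; rewrite i0.
Qed.

Lemma truncation_between (psi : k.-1.-tuple R -> R) :
  0 <= (equivariant_estimator S i psi w -
        equivariant_estimator S i (truncation p N i psi) w) *
       (equivariant_estimator S i (truncation p N i psi) w -
        linex_const p N * (\sum_j S j w / sigma j) * sigma i).
Proof.
rewrite -mulrA weighted_sumE /equivariant_estimator -/u.
set Si := S i w; set x := psi u; set y := truncation _ _ _ _ _; set z := linex_const p N.
have -> : (Si * x - Si * y) * (Si * y - z * (Si * A)) = Si ^+ 2 * ((x - y) * (y - z * A)).
  by ring.
rewrite mulr_ge0 ?sqr_ge0// /y /truncation -/x.
have [xl|lx] := leP x (psi_lower p N i u).
  by rewrite mulr_le0// subr_le0//; exact: lower_le.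
have [xu|ux] := ltP x%:E (psi_upper p N i u); first by rewrite subrr mul0r.
have uf : psi_upper p N i u \is a fin_num.
  by rewrite fin_numE; apply/andP; split; apply/eqP => uE; move: upper_ge ux; rewrite uE.
by rewrite mulr_ge0// subr_ge0 -lee_fin fineK//; exact: upper_ge.
Qed.

(** With equal scales, the upper bound of the truncation at the least index is
    itself the best multiple of the weighted sum. *)
Lemma truncation_lowest (psi : k.-1.-tuple R -> R) :
  (forall j, sigma j = 1) -> i = 0%N :> nat ->
  0 <= equivariant_estimator S i (truncation p N i psi) w <=
       linex_const p N * (\sum_j S j w / sigma j) * sigma i.
Proof.
move=> sigma1 i0; rewrite -mulrA weighted_sumE /equivariant_estimator -/u.
rewrite mulrCA pmulr_rge0// ler_pM2l//.
have lE : psi_lower p N i u = linex_const p N by rewrite /psi_lower i0.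
have uE : psi_upper p N i u = (linex_const p N * A)%:E.
  rewrite /psi_upper i0 eqxx; congr (_ * (_ + _))%:E; apply: eq_bigr => j _.
  by rewrite !sigma1 divr1 mulr1.
have := lower_le; rewrite /truncation uE lE lte_fin => lA.
have l0 := linex_const_gt0.
case: ifPn => [_|]; first by rewrite ltW.
rewrite -ltNge => lx; case: ifPn => [xA|_] /=; first by rewrite !ltW// (lt_trans l0).
by rewrite lexx andbT (le_trans (ltW l0)).
Qed.

End truncation_between.

End estimators.

(** * The k samples *)

Section samples.
Context (R : realType) (k : nat) (n : 'I_k -> nat).

Let sample_index : finType := {j : 'I_k & 'I_(n j)}.

Definition group_sum (j : 'I_k) (x : fun_space R sample_index) : R :=
  \sum_(l < n j) x (Tagged (fun j => 'I_(n j)) l).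

Lemma card_sample_index : #|{: {j : 'I_k & 'I_(n j)}}| = (\sum_j n j)%N.
Proof.
by rewrite card_tagged sumnE big_map big_enum; apply: eq_bigr => j _; rewrite card_ord.
Qed.

Lemma measurable_group_sum j : measurable_fun setT (group_sum j).
Proof. by apply: measurable_sum => l; exact: measurable_coord. Qed.

Lemma weighted_sum_groups (sigma : 'I_k -> R) (x : fun_space R sample_index) :
  weighted_sum (fun a => (sigma (tag a))^-1) x = \sum_j group_sum j x / sigma j.
Proof.
under [RHS]eq_bigr do rewrite mulr_suml.
rewrite (sig_big_dep (J := fun j => 'I_(n j)) xpredT (fun=> xpredT)
  (fun j l => x (Tagged (fun j => 'I_(n j)) l) / sigma j))/=.
by apply: eq_bigr => -[j l] _ /=; rewrite mulrC.
Qed.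

Lemma group_sum_scale j c x : group_sum j (fun a => c * x a) = c * group_sum j x.
Proof. by rewrite /group_sum mulr_sumr. Qed.

(** Ratios are unchanged by a common factor; this also holds where [S i]
    vanishes, with the convention that the quotient is then 0. *)
Lemma homogeneous_equivariant_estimator (i : 'I_k) (psi : k.-1.-tuple R -> R) :
  homogeneous (equivariant_estimator group_sum i psi).
Proof.
move=> c x c0; rewrite /equivariant_estimator group_sum_scale mulrA.
congr (_ * psi _); apply: eq_from_tnth => j; rewrite !tnth_mktuple.
by rewrite !group_sum_scale invfM mulrACA divff ?mul1r// gt_eqF.
Qed.

Lemma exponential_samplesW d (T : measurableType d)
    (X : forall j, 'I_(n j) -> {mfun T >-> R}) (sigma : 'I_k -> R)
    (P : probability T R) :
  exponential_samples X sigma P ->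
  independent_exponentials P (fun a : sample_index => X (tag a) (tagged a) : T -> R)
    (fun a => (sigma (tag a))^-1).
Proof.
move=> [ind law]; split => //.
- move=> B mB; have := ind [set: sample_index]%SET B mB.
  rewrite (eq_bigl xpredT) => [<-|a]; last by rewrite finset.inE.
  congr (P _); apply/seteqP; split => t /= tB; first by move=> a _; exact: tB.
  by move=> a; apply: tB; rewrite /= finset.inE.
- by move=> a C mC; exact: (law (tag a) (tagged a) C mC).
Qed.

End samples.

Theorem theorem2p2 (R : realType) (k : nat) (hk : (1 < k)%N)
    (n : 'I_k -> nat) (hn : forall j, (0 < n j)%N)
    (p : R) (hp : p != 0)
    (d : measure_display) (T : measurableType d)
    (X : forall j, 'I_(n j) -> {mfun T >-> R})
    (P : ('I_k -> R) -> probability T R)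
    (hX : forall sigma, ordered_scales sigma ->
            exponential_samples X sigma (P sigma))
    (i : 'I_k) (psi : k.-1.-tuple R -> R) (hpsi : measurable_fun setT psi) :
  let S := sample_sum X in
  let psi0 := truncation p (\sum_j n j)%N i psi in
  forall (hfin : (0 < i)%N ->
            finite_risk_somewhere p P i (equivariant_estimator S i psi0))
    (hne : exists sigma, ordered_scales sigma /\
       (0 < P sigma [set w | psi0 (ratios S i w) <> psi (ratios S i w)])%E),
  improves_upon p P i (equivariant_estimator S i psi0)
                      (equivariant_estimator S i psi).
Proof.
move=> S psi0 hfin hne.
pose I : finType := {j : 'I_k & 'I_(n j)}.
pose Y (a : I) : T -> R := X (tag a) (tagged a).
pose la (sigma : 'I_k -> R) (a : I) := (sigma (tag a))^-1.
have la0 sigma : ordered_scales sigma -> forall a, 0 < la sigma a.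
  by move=> [sigma0 _] a; rewrite invr_gt0.
have hY sigma (hs : ordered_scales sigma) :
    independent_exponentials (P sigma) Y (la sigma).
  exact: exponential_samplesW (hX _ hs).
have cardI : #|{: I}| = (\sum_j n j)%N by exact: card_sample_index.
pose f := equivariant_estimator (@group_sum R k n) i psi.
pose f0 := equivariant_estimator (@group_sum R k n) i psi0.
have mS j := @measurable_group_sum R k n j.
have mpsi0 : measurable_fun setT psi0 by exact: measurable_truncation.
have mf : measurable_fun setT f by exact: measurable_equivariant_estimator.
have mf0 : measurable_fun setT f0 by exact: measurable_equivariant_estimator.
have fZ : homogeneous f by exact: homogeneous_equivariant_estimator.
have f0Z : homogeneous f0 by exact: homogeneous_equivariant_estimator.
have S_gt0 sigma : ordered_scales sigma ->
    {ae P sigma, forall t j, 0 < group_sum j (Y ^~ t)}.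
  move=> hs; have := exponentials_gt0 (hY _ hs).
  apply: filterS => t Yt j; rewrite /group_sum.
  have i0 : 'I_(n j) by exact: Ordinal (hn j).
  rewrite (bigD1 i0)//= ltr_wpDr// ?Yt// sumr_ge0// => l _.
  exact/ltW/Yt.
have between sigma : ordered_scales sigma -> {ae P sigma, forall t,
    0 <= (f (Y ^~ t) - f0 (Y ^~ t)) * (f0 (Y ^~ t) -
      linex_const p #|I| * weighted_sum (la sigma) (Y ^~ t) * sigma i)}.
  move=> hs; move: (S_gt0 _ hs); apply: filterS => t St.
  rewrite cardI weighted_sum_groups.
  exact: (@truncation_between R _ (fun_space R I) k (@group_sum R k n) i p
    (\sum_j n j)%N sigma (Y ^~ t) hp hs St psi).
have riskE (g : fun_space R I -> R) sigma :
    risk p P i (fun w => g (Y ^~ w)) sigma =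
    (\int[P sigma]_t (linex p (sigma i) (g (Y ^~ t)))%:E)%E.
  by rewrite /risk unlock.
split=> [sigma hs|].
  have s0 : 0 < sigma i by case: hs => + _; apply.
  rewrite (riskE f) (riskE f0).
  exact: (linex_risk_le (la0 _ hs) (hY _ hs) hp s0 mf mf0 fZ f0Z (between _ hs)).
have [sigma [hs fin0]] : finite_risk_somewhere p P i (equivariant_estimator S i psi0).
  (* For the least index, equal scales give a finite risk. *)
  have [i0|] := posnP i; last exact: hfin.
  pose sigma : 'I_k -> R := fun=> 1.
  have hs : ordered_scales sigma by split => [j|j l _]; rewrite /sigma.
  exists sigma; split => //; rewrite (riskE f0).
  have s0 : 0 < sigma i by [].
  apply: (linex_risk_lty (la0 _ hs) (hY _ hs) hp s0 mf0).
  move: (S_gt0 _ hs); apply: filterS => t St.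
  rewrite cardI weighted_sum_groups.
  exact: (@truncation_lowest R _ (fun_space R I) k (@group_sum R k n) i p
    (\sum_j n j)%N sigma (Y ^~ t) hp hs St psi (fun=> erefl) i0).
exists sigma; split => //.
have s0 : 0 < sigma i by case: hs => + _; apply.
move: fin0; rewrite (riskE f) (riskE f0) => fin0.
have [fin|] := ltP (\int[P sigma]_t (linex p (sigma i) (f (Y ^~ t)))%:E)%E +oo%E; last first.
  by rewrite leye_eq => /eqP ->.
apply: (linex_risk_lt (la0 _ hs) (hY _ hs) hp s0 mf mf0 fZ f0Z (between _ hs)) => //.
have [tau [ht pos]] := hne.
pose A : set (fun_space R I) := [set x | f0 x <> f x].
have mA : measurable A by exact: measurable_neq_fun.
have mAY : measurable [set t | A (Y ^~ t)].
  have [mY _ _] := hY _ ht; rewrite -[mkset _]setTI.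
  by have := measurable_to_fun_space mY; apply.
apply: (exponentials_absolutely_continuous (la0 _ hs) (la0 _ ht) (hY _ hs) (hY _ ht) mA).
(* Where S i is positive, the estimators differ as soon as psi0 and psi do. *)
have [N [mN N0 subN]] := S_gt0 _ ht.
have mR : measurable_fun setT (ratios S i).
  by apply: measurable_ratios => j; exact: measurable_sum.
apply: (lt_le_trans pos); rewrite -(measureU0 mAY mN N0).
apply: le_measure; rewrite ?inE.
- by apply: measurable_neq_fun; exact: measurableT_comp mR.
- exact: (measurableU _ _ mAY mN).
move=> w /= neq; have [|Sw] := pselect (N w); [by right|left].
have {}Sw : forall j, 0 < group_sum j (Y ^~ w).
  by apply: contrapT => /= nS; apply/Sw/subN.
move=> eqf; apply: neq; have : S i w * psi0 (ratios S i w) = S i w * psi (ratios S i w).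
  exact: eqf.
by apply: mulfI; rewrite gt_eqF//; exact: Sw.
Qed.
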